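(* Let $d>e\ge2$ be integers and let $f(z)=z^d+z^e+c\in\mathbb{Q}[z]$ with $c=a/b\in\mathbb{Q}$ and $|c|>2$. If $n\in\mathcal{Z}(f,0)$, then $n\le 6$.
   Context: Write $f^n(0)=A_n/B_n$ in lowest terms with $B_n>0$, where $f^n$ denotes the $n$-th iterate of $f$. A prime $p$ is a primitive prime divisor of $A_n$ if $p\mid A_n$ but $p\nmid A_m$ for all $1\le m<n$. The Zsigmondy set is $\mathcal{Z}(f,0)=\{n\ge1: A_n\text{ has no primitive prime divisor}\}$. *)

(* Defs.v *)
From mathcomp Require Import all_boot all_order all_algebra.
Set Implicit Arguments. Unset Strict Implicit. Unset Printing Implicit Defensive.
Import Order.TTheory GRing.Theory Num.Theory.
Local Open Scope ring_scope.

Definition trinomial (d e : nat) (c : rat) : {poly rat} := 'X^d + 'X^e + c%:P.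

Definition iterate (f : {poly rat}) (n : nat) (x : rat) : rat :=
  iter n (horner f) x.

(* [numq] is the numerator in lowest terms with positive denominator. *)
Definition orbit_num (f : {poly rat}) (x : rat) (n : nat) : int :=
  numq (iterate f n x).

Definition primitive_prime_divisor (A : nat -> int) (n p : nat) : Prop :=
  [/\ prime p, (p%:Z %| A n)%Z
    & forall m : nat, (1 <= m < n)%N -> ~~ (p%:Z %| A m)%Z].

Definition in_Zsigmondy (f : {poly rat}) (x : rat) (n : nat) : Prop :=
  (1 <= n)%N /\ ~ exists p : nat, primitive_prime_divisor (orbit_num f x) n p.

(* Main.v *)
(* The Zsigmondy set is in fact empty. Every term of the orbit after [0] has a
   power of [b] as denominator, and integrality gives |A_{n+1}| >= A_n^2, whence
   |A_1 ... A_{n-1}| < |A_n|. On the other hand z^2 divides f(z) - c, so (A_n)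
   is a rigid divisibility sequence: a prime [p] first dividing [A_m] never
   divides a term to a higher power than it divides [A_m]. Without a primitive
   prime divisor, [A_n] would therefore divide A_1 ... A_{n-1}. *)
Require Import Defs.
From mathcomp Require Import all_boot all_order all_algebra.
From mathcomp Require Import ring zify.
Import Order.TTheory GRing.Theory Num.Theory.
Local Open Scope ring_scope.

Lemma horner_trinomial (d e : nat) (c x : rat) :
  (trinomial d e c).[x] = x ^+ d + x ^+ e + c.
Proof. by rewrite /trinomial !hornerE. Qed.

(** The leading term dominates. With [a = |A|] and [T = a ^ (d - 3)], the bound [B <= a] makes the
    other two terms at most [a ^ 2 * B * T] and [a * B ^ 2 * T], which leaves
    [(a ^ 3 - a ^ 2 * B - a * B ^ 2) * T] as a lower bound. *)
Lemma trinomial_form_growth (d e : nat) (A B C : int) :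
  (2 <= e)%N -> (e < d)%N -> 0 < B -> 2 * B < `|A| ->
  `|C| <= `|A| * B ^+ d.-1 ->
  `|A| ^+ 2 <= `|A ^+ d + A ^+ e * B ^+ (d - e) + C|
  /\ `|A| * B ^+ d.-1 <= `|A ^+ d + A ^+ e * B ^+ (d - e) + C|.
Proof.
move=> he hde B0 hA hC.
set N := _ + C.
have [e' de] : exists e', e = e'.+2 by exists e.-2; lia.
have [g dd] : exists g, d = (e' + g).+3 by exists (d - e).-1; lia.
have hAB : B <= `|A| by lia.
have hA1 : 1 <= `|A| by lia.
have tri : `|A| ^+ d <= `|N| + `|A| ^+ e * B ^+ (d - e) + `|C|.
  rewrite -normrX -[B in _ * B ^+ _](gtr0_norm B0) -!normrX -normrM.
  have -> : A ^+ d = N - A ^+ e * B ^+ (d - e) - C by rewrite /N; ring.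
  by do 2 (apply: le_trans (ler_normB _ _) _; rewrite ?lerD2r).
have dg : (d - e = g.+1)%N by lia.
move: tri hC; rewrite dg dd de /=.
set a := `|A| in hA hAB hA1 *; move=> tri hC.
have hg : B ^+ g <= a ^+ g by apply: lerXn2r => //; rewrite ?nnegrE; lia.
have hT : B ^+ (e' + g) <= a ^+ (e' + g)
  by apply: lerXn2r => //; rewrite ?nnegrE; lia.
have T1 : 1 <= a ^+ (e' + g) by apply: exprn_ege1.
have a2 : 0 <= a ^+ e'.+2 * B by apply: mulr_ge0; rewrite ?exprn_ge0; lia.
have h1 : a ^+ e'.+2 * B ^+ g.+1 <= a ^+ 2 * B * a ^+ (e' + g).
  have -> : a ^+ e'.+2 * B ^+ g.+1 = a ^+ e'.+2 * B * B ^+ g by rewrite (exprS B g); ring.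
  have -> : a ^+ 2 * B * a ^+ (e' + g) = a ^+ e'.+2 * B * a ^+ g
    by rewrite (exprD a e' g) !(exprS a); ring.
  exact: ler_wpM2l.
have h2 : a * B ^+ (e' + g).+2 <= a * B ^+ 2 * a ^+ (e' + g).
  have -> : a * B ^+ (e' + g).+2 = a * B ^+ 2 * B ^+ (e' + g)
    by rewrite !(exprS B); ring.
  by apply: ler_wpM2l => //; rewrite mulr_ge0 ?exprn_ge0; lia.
have h3 : a ^+ (e' + g).+3 = a ^+ 3 * a ^+ (e' + g) by rewrite !(exprS a _); ring.
rewrite h3 in tri.
set T := a ^+ (e' + g) in tri h1 h2 T1 *.
have low : a ^+ 3 * T - a ^+ 2 * B * T - a * B ^+ 2 * T <= `|N| by lia.
(* Integrality turns [2 * B < a] into [2 * B + 1 <= a]; the extra unit is what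
   makes the bound as large as [a ^+ 2]. *)
split; [apply: le_trans low | apply: (le_trans h2); apply: le_trans low];
  rewrite -subr_ge0.
- have -> : a ^+ 3 * T - a ^+ 2 * B * T - a * B ^+ 2 * T - a ^+ 2
    = a ^+ 2 * T * (a - (2 * B + 1)) + a * B * T * (a - B) + a ^+ 2 * (T - 1) by ring.
  by rewrite !addr_ge0 // ?mulr_ge0 ?exprn_ge0 //; lia.
- have -> : a ^+ 3 * T - a ^+ 2 * B * T - a * B ^+ 2 * T - a * B ^+ 2 * T
    = a * T * (a - 2 * B) * (a + B) by ring.
  by rewrite !mulr_ge0 //; lia.
Qed.

(* The denominators along the orbit of [0] are powers of [denq c], which lets
   the recursion be carried out on numerators without any cancellation. *)
Lemma trinomial_fraction (d e k : nat) (c x : rat) :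
  (2 <= e)%N -> (e < d)%N -> denq x = denq c ^+ k.+1 ->
  numq (trinomial d e c).[x]
    = numq x ^+ d + numq x ^+ e * denq x ^+ (d - e)
      + numq c * denq c ^+ (k.+1 * d).-1
  /\ denq (trinomial d e c).[x] = denq x ^+ d.
Proof.
move=> he hde hk; rewrite horner_trinomial.
set N := (X in numq _ = X).
have hd0 : (0 < k.+1 * d)%N by rewrite muln_gt0; lia.
have B0 : ((denq x)%:~R : rat) != 0 by rewrite intr_eq0 denq_neq0.
have b0 : ((denq c)%:~R : rat) != 0 by rewrite intr_eq0 denq_neq0.
have hpow : denq x ^+ d = denq c * denq c ^+ (k.+1 * d).-1.
  by rewrite hk -exprM -exprS prednK.
have eN : x ^+ d + x ^+ e + c = N%:~R / (denq x ^+ d)%:~R.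
  apply: (canRL (mulfK _)); first by rewrite rmorphXn expf_neq0.
  rewrite /N !rmorphD !rmorphM !rmorphXn /= !mulrDl.
  congr (_ + _ + _).
  - by rewrite -{1}[x]divq_num_den -exprMn divfK.
  - rewrite -{1}[x]divq_num_den -{1}(subnKC (ltnW hde)) exprD mulrA.
    by rewrite -exprMn divfK.
  - by rewrite -rmorphXn /= hpow rmorphM mulrA -{1}[c]divq_num_den divfK // rmorphXn.
(* Every term of [N] but the first contains a factor [denq c], so [N] is congruent to [numq x ^ d]
   modulo [denq c], and [numq x] is prime to [denq c]. *)
have cop : coprime `|N| `|denq x ^+ d|.
  rewrite -[coprime _ _]/(coprimez N (denq x ^+ d)).
  rewrite hk -exprM; apply: coprimezXr.
  rewrite coprimez_sym /coprimez.
  have [j hj] : exists j, ((k.+1 * d).-1 = j.+1)%N.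
    by exists (k.+1 * d).-2; nia.
  have [g hg] : exists g, (d - e = g.+1)%N by exists (d - e).-1; lia.
  have -> : N = (numq x ^+ e * denq c ^+ k * denq x ^+ g + numq c * denq c ^+ j) * denq c
     + numq x ^+ d.
    by rewrite /N hj hg !exprS {1}hk !exprS; ring.
  rewrite gcdzMDl -/(coprimez _ _); apply: coprimezXr.
  rewrite coprimezE coprime_sym; move: (coprime_num_den x).
  by rewrite hk exprS abszM coprimeMr => /andP[].
rewrite eN coprimeq_num // coprimeq_den // expf_eq0 (negPf (denq_neq0 x)) andbF.
by rewrite normrX gtr0_sg ?exprn_gt0 // mul1r gtr0_norm.
Qed.

Lemma numq_gt_denq (c : rat) : 2 < `|c| -> 2 * denq c < `|numq c|.
Proof.
rewrite -{1}[c]divq_num_den normf_div -!intr_norm (gtr0_norm (denq_gt0 c)).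
rewrite ltr_pdivlMr ?ltr0z ?denq_gt0 //.
by rewrite -[2]/(2%:~R) -intrM ltr_int.
Qed.

(** The inequality assumed on [numq x] is [|c| <= |x|] cleared of denominators. It gives both size
    hypotheses of the growth lemma, whose second bound returns the same inequality for [x']. *)
Lemma trinomial_orbit_step (d e k : nat) (c x : rat) :
  (2 <= e)%N -> (e < d)%N -> 2 < `|c| ->
  denq x = denq c ^+ k.+1 -> `|numq c| * denq c ^+ k <= `|numq x| ->
  let x' := (trinomial d e c).[x] in
  [/\ denq x' = denq c ^+ (k.+1 * d).-1.+1,
      `|numq c| * denq c ^+ (k.+1 * d).-1 <= `|numq x'|
    & `|numq x| ^+ 2 <= `|numq x'| ].
Proof.
move=> he hde hc hk hx /=.
have [numE denE] := trinomial_fraction d e k c x he hde hk.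
have hcb := numq_gt_denq c hc.
have hB : 0 < denq c ^+ k by rewrite exprn_gt0 ?denq_gt0.
have hd0 : (0 < k.+1 * d)%N by rewrite muln_gt0 (leq_ltn_trans _ hde).
have hexp : denq c ^+ (k.+1 * d).-1 = denq c ^+ k * denq x ^+ d.-1.
  by rewrite hk -exprM -exprD; rewrite -{1}(ltn_predK hde) mulnS addSn.
have hC : `|numq c * denq c ^+ (k.+1 * d).-1| = `|numq c| * denq c ^+ (k.+1 * d).-1.
  by rewrite normrM (ger0_norm (exprn_ge0 _ (ltW (denq_gt0 c)))).
have hCle : `|numq c| * denq c ^+ (k.+1 * d).-1 <= `|numq x| * denq x ^+ d.-1.
  by rewrite hexp mulrA ler_wpM2r // exprn_ge0 // ltW // denq_gt0.
have hA : 2 * denq x < `|numq x|.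
  apply: lt_le_trans hx; rewrite hk exprS mulrA ltr_pM2r //.
have [] := trinomial_form_growth d e (numq x) (denq x)
  (numq c * denq c ^+ (k.+1 * d).-1) he hde (denq_gt0 x) hA.
  by rewrite hC.
rewrite -numE => hsq hlow; split => //.
- by rewrite denE hk -exprM prednK.
- exact: le_trans hCle hlow.
Qed.

Lemma trinomial_orbit1 (d e : nat) (c : rat) :
  (2 <= e)%N -> (e < d)%N -> iterate (trinomial d e c) 1 0 = c.
Proof.
by move=> he hde; rewrite /iterate /= horner_trinomial !expr0n !gtn_eqF ?add0r //; lia.
Qed.

(** The witness built by the induction satisfies [k.+1 = d ^ n]. *)
Lemma trinomial_orbit_inv (d e n : nat) (c : rat) :
  (2 <= e)%N -> (e < d)%N -> 2 < `|c| ->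
  exists k, denq (iterate (trinomial d e c) n.+1 0) = denq c ^+ k.+1 /\
    `|numq c| * denq c ^+ k <= `|numq (iterate (trinomial d e c) n.+1 0)|.
Proof.
move=> he hde hc; elim: n => [|n [k [hk hx]]].
  by exists 0%N; rewrite trinomial_orbit1 // expr1 expr0 mulr1.
have [hk' hx' _] := trinomial_orbit_step d e k c _ he hde hc hk hx.
by exists (k.+1 * d).-1.
Qed.

Lemma orbit_num_sqr_le (d e n : nat) (c : rat) :
  (2 <= e)%N -> (e < d)%N -> 2 < `|c| ->
  `|orbit_num (trinomial d e c) 0 n.+1| ^+ 2
    <= `|orbit_num (trinomial d e c) 0 n.+2|.
Proof.
move=> he hde hc; have [k [hk hx]] := trinomial_orbit_inv d e n c he hde hc.
by have [] := trinomial_orbit_step d e k c _ he hde hc hk hx.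
Qed.

(** If the product [P] of the earlier terms is below [A], then [P * A < A ^ 2], which is at most the
    next term. The induction starts from the empty product [1 < |numq c|]. *)
Lemma prod_orbit_num_lt (d e n : nat) (c : rat) :
  (2 <= e)%N -> (e < d)%N -> 2 < `|c| ->
  (\prod_(1 <= m < n.+1) `|orbit_num (trinomial d e c) 0 m|
     < `|orbit_num (trinomial d e c) 0 n.+1|)%N.
Proof.
move=> he hde hc; elim: n => [|n IH].
  rewrite big_geq // /orbit_num trinomial_orbit1 //.
  by have := numq_gt_denq c hc; have := denq_gt0 c; lia.
rewrite big_nat_recr //=.
have := orbit_num_sqr_le d e n c he hde hc.
set A := orbit_num _ _ _ in IH *; set P := \prod_(_ <= _ < _) _ in IH *.
move=> hA; nia.
Qed.

(** This transports the orbit to residue rings: where [denq c] is invertible, the numerators vanish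
    exactly when the iterates computed in [R] do. *)
Lemma trinomial_orbit_ring (R : comUnitRingType) (d e n : nat) (c : rat) :
  (2 <= e)%N -> (e < d)%N -> 2 < `|c| ->
  ((denq c)%:~R : R) \is a GRing.unit ->
  iter n (fun y : R => y ^+ d + y ^+ e + (numq c)%:~R / (denq c)%:~R) 0
    * (denq (iterate (trinomial d e c) n 0))%:~R
  = (numq (iterate (trinomial d e c) n 0))%:~R.
Proof.
move=> he hde hc hu; elim: n => [|n IH]; first by rewrite mul0r.
case: n IH => [_|n IH].
  rewrite trinomial_orbit1 //= !expr0n !gtn_eqF ?add0r ?divrK //; lia.
have [k [hk hx]] := trinomial_orbit_inv d e n c he hde hc.
have [numE denE] := trinomial_fraction d e k c _ he hde hk.
rewrite iterS [iterate _ _.+2 _]/(_.[iterate _ _.+1 _]) numE denE.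
move: (iter n.+1 _ _) IH => y IH; set x := iterate _ _ _ in IH hk *.
have hd0 : (0 < k.+1 * d)%N by rewrite muln_gt0 (leq_ltn_trans _ hde).
have hpow : denq x ^+ d = denq c * denq c ^+ (k.+1 * d).-1.
  by rewrite hk -exprM -exprS prednK.
rewrite !rmorphD !rmorphM !rmorphXn /= -IH !mulrDl; congr (_ + _ + _).
- by rewrite exprMn.
- by rewrite -{1}(subnKC (ltnW hde)) exprD exprMn mulrA.
- by rewrite -rmorphXn /= hpow rmorphM mulrA divrK // rmorphXn.
Qed.

(** For [q <= 1] the type ['Z_q] is by convention the ring with two elements, hence the bound on
    [q]. *)
Lemma intr_Zp_eq0 (q : nat) (z : int) :
  (1 < q)%N -> ((z%:~R : 'Z_q) == 0) = (q %| `|z|)%N.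
Proof.
move=> hq.
have natE (k : nat) : ((k%:R : 'Z_q) == 0) = (q %| k)%N.
  by rewrite -(inj_eq val_inj) /= val_Zp_nat.
case: z => k; first exact: natE.
by rewrite NegzE rmorphN oppr_eq0 abszN; apply: natE.
Qed.

Lemma intr_Zp_unit (q : nat) (z : int) :
  (1 < q)%N -> ((z%:~R : 'Z_q) \is a GRing.unit) = coprime q `|z|.
Proof.
move=> hq; case: z => k; first exact: unitZpE.
by rewrite NegzE rmorphN unitrN abszN; apply: unitZpE.
Qed.

(* Modulo [p ^ v.+1], where [v] is the valuation of [A_m], the square of the
   [m]-th iterate vanishes, so the orbit becomes purely periodic of period
   [m] from the index [1] on. *)
Lemma orbit_num_rigid (d e m p : nat) (c : rat) :
  (2 <= e)%N -> (e < d)%N -> 2 < `|c| -> prime p -> (0 < m)%N ->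
  let A := orbit_num (trinomial d e c) 0 in
  (0 < `|A m|)%N -> (p %| `|A m|)%N ->
  (forall j, (0 < j < m)%N -> ~~ (p %| `|A j|)%N) ->
  forall n, (0 < n)%N -> ~~ (p ^ (logn p `|A m|).+1 %| `|A n|)%N.
Proof.
move=> he hde hc pp m0 A Am0 pA hmin.
set v := logn p _; set q := (p ^ v.+1)%N.
have v0 : (0 < v)%N by rewrite logn_gt0 mem_primes pp Am0.
have q1 : (1 < q)%N by rewrite (leq_trans (prime_gt1 pp)) // -{1}(expn1 p) leq_exp2l ?prime_gt1.
(* [p] divides [A m], which is prime to its denominator, a positive power of [denq c]. *)
have pb : coprime p `|denq c|.
  have [k] := trinomial_orbit_inv d e m.-1 c he hde hc; rewrite prednK // => -[hk _].
  have := coprime_num_den (iterate (trinomial d e c) m 0).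
  rewrite hk exprS abszM coprimeMr => /andP[cop _].
  exact: coprime_dvdl pA cop.
have bu : ((denq c)%:~R : 'Z_q) \is a GRing.unit.
  by rewrite intr_Zp_unit // coprimeXl.
pose g (y : 'Z_q) := y ^+ d + y ^+ e + (numq c)%:~R / (denq c)%:~R.
have orbE n := trinomial_orbit_ring 'Z_q d e n c he hde hc bu.
have Du n : (0 < n)%N -> ((denq (iterate (trinomial d e c) n 0))%:~R : 'Z_q) \is a GRing.unit.
  case: n => // n _; have [k [-> _]] := trinomial_orbit_inv d e n c he hde hc.
  by rewrite rmorphXn unitrX.
have zeroE n : (0 < n)%N -> (q %| `|A n|)%N = (iter n g 0 == 0).
  by move=> n0; rewrite -intr_Zp_eq0 // -orbE mulIr_eq0 //; apply/mulIr/Du.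
(* [A m ^ 2] has valuation [2 * v >= v.+1], because [v] is positive. *)
have sq0 : iter m g 0 ^+ 2 = 0.
  apply: (mulIr (unitrX 2 (Du m m0))); rewrite mul0r -exprMn orbE -rmorphXn.
  apply/eqP; rewrite intr_Zp_eq0 // abszX -/(A m).
  by rewrite pfactor_dvdn ?expn_gt0 ?Am0 // lognX -/v; lia.
(* Both exponents are at least 2, so [y ^ 2 = 0] forces [g y = g 0]. *)
have per j : iter (j.+1 + m) g 0 = iter j.+1 g 0.
  elim: j => [|j IH]; last by rewrite addSn [LHS]iterS IH.
  rewrite add1n iterS; move: sq0; move: (iter m g 0) => y sq0.
  rewrite /= /g -(subnKC he) -(subnKC (ltnW (leq_ltn_trans he hde))).
  by rewrite !exprD sq0 [0 ^+ 2]expr0n !mul0r.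
(* Below [m] the minimality of [m] applies, at [m] the definition of [v], and beyond [m] one period
   is subtracted. *)
elim/ltn_ind => n IH n0.
case: (ltngtP n m) => [nm|mn|->].
- apply: contra (hmin n _); last by rewrite n0.
  by apply: dvdn_trans; rewrite dvdn_exp.
- have [j nj] : exists j, n = (j.+1 + m)%N by exists (n - m).-1; lia.
  rewrite nj zeroE // per -zeroE //; apply: IH => //; lia.
- by rewrite pfactor_dvdn // ltnn.
Qed.

Theorem theorem1p3 (d e : nat) (c : rat) (n : nat)
    (he : (2 <= e)%N) (hde : (e < d)%N) (hc : 2 < `|c|)
    (hn : in_Zsigmondy (trinomial d e c) 0 n) :
  (n <= 6)%N.
Proof.
exfalso; case: n hn => [|n] [] // _ hn.
pose A := orbit_num (trinomial d e c) 0.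
have A0 j : (0 < j)%N -> (0 < `|A j|)%N.
  by case: j => // j _; apply: leq_ltn_trans (prod_orbit_num_lt d e j c he hde hc).
have := prod_orbit_num_lt d e n c he hde hc; rewrite ltnNge -/A => /negP; apply.
apply: dvdn_leq; first by rewrite big_nat_cond prodn_cond_gt0 // => i /andP[/andP[/A0]].
apply/dvdn_partP => [|p]; first exact: A0.
rewrite mem_primes => /and3P[pp _ pA].
have exA : exists m, (0 < m)%N && (p %| `|A m|)%N by exists n.+1.
(* [m] is the first index at which [p] appears; were it [n.+1], [p] would be a primitive prime
   divisor. *)
case: (ex_minnP exA) => m /andP[m0 pAm] mmin.
have mn : (m < n.+1)%N.
  rewrite ltnNge; apply/negP => nm; apply: hn; exists p; split => // j /andP[j0 jn].
  apply/negP => pj; have /mmin : (0 < j)%N && (p %| `|A j|)%N by rewrite j0.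
  by rewrite leqNgt (leq_trans jn).
(* By rigidity the [p]-part of [A n.+1] already divides the single factor [A m] of the product. *)
apply: (@dvdn_trans `|A m|); last first.
  by rewrite (big_rem m) ?mem_index_iota ?m0 //= dvdn_mulr.
rewrite p_part pfactor_dvdn ?A0 // leqNgt -pfactor_dvdn ?A0 //.
apply: orbit_num_rigid => //; first exact: A0.
move=> j /andP[j0 jm]; apply/negP => pj.
by have := mmin j; rewrite j0 pj leqNgt jm => /(_ isT).
Qed.
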